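(* Let $(f_n)_n$ be a sequence of integrable functions $f_n:G\to\mathbf X_1$ which converges in $\mu$-measure to $0$ on every set $A\in\mathcal A$ with $\mu(A)\in\mathbf X_2$, and suppose that there is an integrable function $h:G\to\mathbf X_1$ with $|f_n(g)|\le h(g)$ for all $n\in\mathbb N$ and $g\in G$. Then $(f_n)_n$ converges in $L^1$ to $0$, that is, $\ell\big(\big(\int_G|f_n(g)|\,d\mu(g)\big)_n\big)=0$.
   Context: Conventions. All vector lattices are Dedekind complete. For such a lattice $Y$: $Y^+=\{y\in Y:y\ge 0\}$, $|y|=y\vee(-y)$, $\overline Y^+=Y^+\cup\{+\infty\}$ with order and operations extended in the natural way and $0\cdot(+\infty)=0$. An $(o)$-sequence in $Y$ is a decreasing sequence in $Y^+$ with infimum $0$. ''Definitely'' means for all but finitely many $n$. The supremum of an empty family of positive elements is $0$. Convergences. A convergence on $Y$ is a pair $(\mathcal S,\ell)$, where $\mathcal S$ is a linear subspace of the space of all sequences in $Y$ and $\ell:\mathcal S\to Y$ satisfies: (a) $\ell$ is linear; (b) if $(x_n),(y_n)\in\mathcal S$ and $x_n\le y_n$ definitely, then $\ell((x_n))\le\ell((y_n))$; (c) if $x_n=c$ definitely then $(x_n)\in\mathcal S$ and $\ell((x_n))=c$; if $(x_n)\in\mathcal S$ and $x_n\ne y_n$ for only finitely many $n$, then $(y_n)\in\mathcal S$ and $\ell((y_n))=\ell((x_n))$; (d) if $(x_n)\in\mathcal S$ then $(|x_n|)\in\mathcal S$ and $\ell((|x_n|))=|\ell((x_n))|$; (e)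 if $(x_n),(z_n)\in\mathcal S$, $\ell((x_n))=\ell((z_n))$ and $x_n\le y_n\le z_n$ definitely, then $(y_n)\in\mathcal S$; (f) for $u\in Y^+$, $(\frac1n u)_n\in\mathcal S$ and $\ell((\frac1n u)_n)=0$. Writing $\ell((x_n)_n)=c$ means that $(x_n)_n$ is a sequence in $Y$ belonging to $\mathcal S$ and that the value of $\ell$ is $c$. Limit superior. Each convergence $(\mathcal S,\ell)$ comes with a map $\overline\ell$ from the set of sequences in $Y^+$ to $\overline Y^+$ such that: (a) $\overline\ell((x_n))=\overline\ell((y_n))$ if $x_n=y_n$ definitely; (b) $\overline\ell((x_n+y_n))\le\overline\ell((x_n))+\overline\ell((y_n))$; (c) if $x_n\le y_n$ definitely then $\overline\ell((x_n))\le\overline\ell((y_n))$; (d) $\overline\ell((x_n))=\ell((x_n))$ if $(x_n)\in\mathcal S$; (e) if $\overline\ell((x_n))=0$ then $(x_n)\in\mathcal S$ and $\ell((x_n))=0$. Product triples. $(Y_1,Y_2,Y)$, with convergences $\ell_1,\ell_2,\ell$ (and $\overline\ell_1,\overline\ell_2,\overline\ell$), is a product triple if there is a map $\cdot:Y_1\times Y_2\to Y$ with: (1),(2) additivity in each variable; (3) $x_1\ge y_1$ and $x_2\ge0$ imply $x_1\cdot x_2\ge y_1\cdot x_2$; (4) $x_1\ge0$ and $x_2\ge y_2$ imply $x_1\cdot x_2\ge x_1\cdot y_2$; (5) if $(x_n)$ is an $(o)$-sequence in $Y_1$ and $y\in Y_2^+$, then $(x_n\cdot y)$ is an $(o)$-sequence;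 (6) if $x\in Y_1^+$ and $(y_n)$ is an $(o)$-sequence in $Y_2$, then $(x\cdot y_n)$ is an $(o)$-sequence; (7) $\ell_1((x_n))=0$, $y\in Y_2$ imply $\ell((x_n\cdot y))=0$; (8) $x\in Y_1$, $\ell_2((y_n))=0$ imply $\ell((x\cdot y_n))=0$; (9) $x_n\in Y_1^+$, $\overline\ell_1((x_n))=x$, $y\in Y_2^+$ imply $\overline\ell((x_n\cdot y))=x\cdot y$; (10) $x\in Y_1^+$, $y_n\in Y_2^+$, $\overline\ell_2((y_n))=y$ imply $\overline\ell((x\cdot y_n))=x\cdot y$. $Y$ is a product algebra if $(Y,Y,Y)$ is a product triple. Setting. $(\mathbf X_1,\mathbf X_2,\mathbf X)$ is a product triple with convergences $\ell_1,\ell_2,\ell$; $\mathbf X_1,\mathbf X_2,\mathbf X$ are product algebras; $\mathbb R$ carries a convergence $\ell_{\mathbb R}$, and $(\mathbb R,\mathbf X,\mathbf X)$, $(\mathbb R,\mathbf X_j,\mathbf X_j)$ ($j=1,2$) are product triples. $G$ is a nonempty set, $\mathcal A$ an algebra of subsets of $G$, $\mu:\mathcal A\to\overline{\mathbf X}_2^+$ a finitely additive measure that is $\sigma$-finite: $G=\bigcup_n B_n$ for some $B_n\in\mathcal A$ with $\mu(B_n)\in\mathbf X_2^+$. Simple functions. $f:G\to\mathbf X_1$ is simple if $f=\sum_{j=1}^r c_j\chi_{A_j}$ with $c_j\in\mathbf X_1$, $A_j\in\mathcal A$, $\mu(A_j)\in\mathbf X_2^+$; then $\int_A f\,d\mu=\sum_j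 c_j\cdot\mu(A\cap A_j)$ for $A\in\mathcal A$ (independent of the representation). Convergence in measure. $(f_n)_n$ converges in $\mu$-measure to $f$ on $A\in\mathcal A$ if there is a sequence $(A_n)_n$ in $\mathcal A$ with $\ell_2((\mu(A\cap A_n))_n)=0$ and $\ell_1\big(\big(\bigvee_{g\in A\setminus A_n}|f_n(g)-f(g)|\big)_n\big)=0$. Equiabsolute continuity. The integrals of a sequence $(f_n)_n$ of simple functions are $\mu$-equiabsolutely continuous if: (i) $\ell\big(\big(\int_{A_n}|f_n|\,d\mu\big)_n\big)=0$ for every sequence $(A_n)_n$ in $\mathcal A$ with $\ell_2((\mu(A_n))_n)=0$; (ii) there is an increasing sequence $(B_m)_m$ in $\mathcal A$ with $\mu(B_m)\in\mathbf X_2$ for all $m$ and $\ell\Big(\Big(\overline\ell\Big(\Big(\int_{G\setminus B_m}|f_n|\,d\mu\Big)_n\Big)\Big)_m\Big)=0$. Integral. A sequence $(f_n)_n$ of simple functions is defining for $f:G\to\mathbf X_1$ if it converges in $\mu$-measure to $f$ on every $A\in\mathcal A$ with $\mu(A)\in\mathbf X_2$ and its integrals are $\mu$-equiabsolutely continuous. A positive $f:G\to\mathbf X_1$ is integrable if there are a defining sequence $(f_n)_n$ for $f$ and a map $l:\mathcal A\to\mathbf X$ with $\ell\big(\big(\bigvee_{A\in\mathcal A}|\int_A f_n\,d\mu-l(A)|\big)_n\big)=0$; then $\int_A f\,d\mu:=l(A)$ (this is independent of choices). A general $f:G\to\mathbf X_1$ is integrable if $f^+=f\vee0$ and $f^-=(-f)\vee0$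 are, and $\int_A f\,d\mu=\int_A f^+\,d\mu-\int_A f^-\,d\mu$; then $|f|$ is integrable too. *)

(* Defs.v *)
From HB Require Import structures.
From mathcomp Require Import all_boot all_order all_algebra.
From mathcomp Require Import all_classical all_reals all_analysis.

Set Implicit Arguments.
Unset Strict Implicit.
Unset Printing Implicit Defensive.

Import Order.TTheory GRing.Theory Num.Theory.

Local Open Scope classical_set_scope.
Local Open Scope ring_scope.

(* Dedekind complete vector lattices over R. The binary joins and meets are
   kept as fields of their own: joining Order.Lattice with GRing.Lmodule would
   have to be declared before Num.RealDomain in the hierarchy. *)
HB.mixin Record isDVLattice (R : realType) Y
    & GRing.Lmodule R Y & Num.POrderedZmodule Y := {
  vjoin : Y -> Y -> Y ;
  vmeet : Y -> Y -> Y ;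
  ge_vjoin : forall x y z : Y, (vjoin x y <= z) = (x <= z) && (y <= z) ;
  le_vmeet : forall x y z : Y, (z <= vmeet x y) = (z <= x) && (z <= y) ;
  lev_add2r : forall z x y : Y, x <= y -> x + z <= y + z ;
  scalev_ge0 : forall (a : R) (x : Y), 0 <= a -> 0 <= x -> 0 <= a *: x ;
  vlat_complete : forall A : set Y, has_sup A -> supremums A !=set0
}.

#[short(type="dvlatType")]
HB.structure Definition DVLattice (R : realType) :=
  {Y of GRing.Lmodule R Y & Num.POrderedZmodule Y & isDVLattice R Y}.

Section RealDVLattice.
Context {R : realType}.

Fact real_ge_vjoin (x y z : R^o) :
  (Num.max x y <= z) = (x <= z) && (y <= z).
Proof. exact: ge_max. Qed.

Fact real_le_vmeet (x y z : R^o) :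
  (z <= Num.min x y) = (z <= x) && (z <= y).
Proof. exact: le_min. Qed.

Fact real_lev_add2r (z x y : R^o) : x <= y -> x + z <= y + z.
Proof. by rewrite lerD2r. Qed.

Fact real_scalev_ge0 (a : R) (x : R^o) : 0 <= a -> 0 <= x -> 0 <= a *: x.
Proof. exact: mulr_ge0. Qed.

Fact real_vlat_complete (A : set R^o) : has_sup A -> supremums A !=set0.
Proof.
move=> supA; exists (sup A); split; first exact: sup_upper_bound.
by move=> y Ay; apply: ge_sup => //; case: supA.
Qed.

HB.instance Definition _ := Num.POrderedZmodule.copy R^o R.
HB.instance Definition _ := isDVLattice.Build R R^o real_ge_vjoin
  real_le_vmeet real_lev_add2r real_scalev_ge0 real_vlat_complete.

End RealDVLattice.

Definition vabs (R : realType) (Y : dvlatType R) (y : Y) : Y := vjoin y (- y).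

(* Y with a top element +oo adjoined; its nonnegative part stands for
   Y^+ U {+oo}. *)
Inductive pext (Y : Type) : Type := pfin of Y | pinf.
Arguments pinf {Y}.

Section PExt.
Context {R : realType} {Y : dvlatType R}.

Definition pext_le (u v : pext Y) : Prop :=
  match u, v with
  | _, pinf => True
  | pfin x, pfin y => x <= y
  | pinf, pfin _ => False
  end.

Definition pext_add (u v : pext Y) : pext Y :=
  match u, v with
  | pfin x, pfin y => pfin (x + y)
  | _, _ => pinf
  end.

Definition pfinite (u : pext Y) : Prop := exists y, u = pfin y.

(* meaningful only on finite values *)
Definition pval (u : pext Y) : Y := if u is pfin y then y else 0.

End PExt.

(* A convergence (S, l) together with its limit superior: S = cv_dom,
   l = cv_lim (meaningful only on cv_dom), and cv_limsup is meaningful only on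
   sequences of nonnegative elements. "Definitely" is "near \oo". *)
Record convergence (R : realType) (Y : dvlatType R) := Convergence {
  cv_dom : set (nat -> Y) ;
  cv_lim : (nat -> Y) -> Y ;
  cv_limsup : (nat -> Y) -> pext Y ;
  cv_dom_linear : forall (a b : R) (x y : nat -> Y), cv_dom x -> cv_dom y ->
    cv_dom (fun n => a *: x n + b *: y n) ;
  cv_lim_linear : forall (a b : R) (x y : nat -> Y), cv_dom x -> cv_dom y ->
    cv_lim (fun n => a *: x n + b *: y n) = a *: cv_lim x + b *: cv_lim y ;
  cv_lim_le : forall x y : nat -> Y, cv_dom x -> cv_dom y ->
    (\forall n \near \oo, x n <= y n) -> cv_lim x <= cv_lim y ;
  cv_cst : forall (x : nat -> Y) (c : Y), (\forall n \near \oo, x n = c) ->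
    cv_dom x /\ cv_lim x = c ;
  cv_near_eq : forall x y : nat -> Y, cv_dom x ->
    (\forall n \near \oo, x n = y n) -> cv_dom y /\ cv_lim y = cv_lim x ;
  cv_abs : forall x : nat -> Y, cv_dom x ->
    cv_dom (fun n => vabs (x n)) /\
    cv_lim (fun n => vabs (x n)) = vabs (cv_lim x) ;
  cv_squeeze : forall x y z : nat -> Y, cv_dom x -> cv_dom z ->
    cv_lim x = cv_lim z ->
    (\forall n \near \oo, x n <= y n /\ y n <= z n) -> cv_dom y ;
  cv_harmonic : forall u : Y, 0 <= u ->
    cv_dom (fun n => n.+1%:R^-1 *: u) /\
    cv_lim (fun n => n.+1%:R^-1 *: u) = 0 ;
  cv_limsup_ge0 : forall x : nat -> Y, (forall n, 0 <= x n) ->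
    pext_le (pfin 0) (cv_limsup x) ;
  cv_limsup_near_eq : forall x y : nat -> Y,
    (forall n, 0 <= x n) -> (forall n, 0 <= y n) ->
    (\forall n \near \oo, x n = y n) -> cv_limsup x = cv_limsup y ;
  cv_limsupD : forall x y : nat -> Y,
    (forall n, 0 <= x n) -> (forall n, 0 <= y n) ->
    pext_le (cv_limsup (fun n => x n + y n))
            (pext_add (cv_limsup x) (cv_limsup y)) ;
  cv_limsup_le : forall x y : nat -> Y,
    (forall n, 0 <= x n) -> (forall n, 0 <= y n) ->
    (\forall n \near \oo, x n <= y n) ->
    pext_le (cv_limsup x) (cv_limsup y) ;
  cv_limsup_lim : forall x : nat -> Y, (forall n, 0 <= x n) ->
    cv_dom x -> cv_limsup x = pfin (cv_lim x) ;
  cv_limsup_eq0 : forall x : nat -> Y, (forall n, 0 <= x n) ->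
    cv_limsup x = pfin 0 -> cv_dom x /\ cv_lim x = 0
}.

Section Limits.
Context {R : realType} {Y : dvlatType R} (cv : convergence Y).

Definition cvto (x : nat -> Y) (c : Y) : Prop :=
  cv_dom cv x /\ cv_lim cv x = c.

(* For a limit to be asserted, every term has to lie in Y. *)
Definition pext_cvto (x : nat -> pext Y) (c : Y) : Prop :=
  exists2 y : nat -> Y, (forall n, x n = pfin (y n)) & cvto y c.

(* The suprema of the sets S n, which consist of nonnegative elements, exist in
   Y and converge to 0. Adding the element 0 makes the supremum of the empty
   family equal to 0 and does not affect the others. *)
Definition sup_cvto0 (S : nat -> set Y) : Prop :=
  exists2 z : nat -> Y,
    (forall n, supremums (0 |` S n) (z n)) & cvto z 0.

Definition o_sequence (x : nat -> Y) : Prop :=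
  [/\ forall n, 0 <= x n, forall n, x n.+1 <= x n & infimums (range x) 0].

End Limits.

Record product_triple (R : realType) (Y1 Y2 Y : dvlatType R)
    (cv1 : convergence Y1) (cv2 : convergence Y2) (cv : convergence Y)
    (m : Y1 -> Y2 -> Y) : Prop := ProductTriple {
  pt_addl : forall x1 y1 x2, m (x1 + y1) x2 = m x1 x2 + m y1 x2 ;
  pt_addr : forall x1 x2 y2, m x1 (x2 + y2) = m x1 x2 + m x1 y2 ;
  pt_monol : forall x1 y1 x2, y1 <= x1 -> 0 <= x2 -> m y1 x2 <= m x1 x2 ;
  pt_monor : forall x1 x2 y2, 0 <= x1 -> y2 <= x2 -> m x1 y2 <= m x1 x2 ;
  pt_ol : forall (x : nat -> Y1) y, o_sequence x -> 0 <= y ->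
    o_sequence (fun n => m (x n) y) ;
  pt_or : forall x (y : nat -> Y2), 0 <= x -> o_sequence y ->
    o_sequence (fun n => m x (y n)) ;
  pt_cvl : forall (x : nat -> Y1) y, cvto cv1 x 0 ->
    cvto cv (fun n => m (x n) y) 0 ;
  pt_cvr : forall x (y : nat -> Y2), cvto cv2 y 0 ->
    cvto cv (fun n => m x (y n)) 0 ;
  (* m is only defined on Y1 * Y2, hence the limits superior are finite here
     and in pt_limsupr *)
  pt_limsupl : forall (x : nat -> Y1) x0 y, (forall n, 0 <= x n) ->
    cv_limsup cv1 x = pfin x0 -> 0 <= y ->
    cv_limsup cv (fun n => m (x n) y) = pfin (m x0 y) ;
  pt_limsupr : forall x (y : nat -> Y2) y0, 0 <= x -> (forall n, 0 <= y n) ->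
    cv_limsup cv2 y = pfin y0 ->
    cv_limsup cv (fun n => m x (y n)) = pfin (m x y0)
}.

Definition product_algebra (R : realType) (Y : dvlatType R)
    (cv : convergence Y) : Prop :=
  exists m : Y -> Y -> Y, product_triple cv cv cv m.

Section Measure.
Context {R : realType} {X2 : dvlatType R} {d : measure_display}
  {G : algebraOfSetsType d}.

(* The values of mu outside of the algebra are irrelevant. *)
Record fin_add_measure (mu : set G -> pext X2) : Prop := FinAddMeasure {
  fam_ge0 : forall A, measurable A -> pext_le (pfin 0) (mu A) ;
  fam_set0 : mu set0 = pfin 0 ;
  fam_setU : forall A B, measurable A -> measurable B -> A `&` B = set0 ->
    mu (A `|` B) = pext_add (mu A) (mu B)
}.

Definition sigma_finite_fam (mu : set G -> pext X2) : Prop :=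
  exists B : nat -> set G,
    (forall n, measurable (B n) /\ pfinite (mu (B n))) /\
    \bigcup_n B n = [set: G].

End Measure.

Section Integral.
Context {R : realType} {X1 X2 X : dvlatType R}.
Context (cv1 : convergence X1) (cv2 : convergence X2) (cv : convergence X).
Context (m : X1 -> X2 -> X).
Context {d : measure_display} {G : algebraOfSetsType d}.
Context (mu : set G -> pext X2).

Definition simple_rep (f : G -> X1) (r : nat)
    (c : 'I_r -> X1) (E : 'I_r -> set G) : Prop :=
  (forall j, measurable (E j) /\ pfinite (mu (E j))) /\
  (forall g, f g = \sum_(j < r) (\1_(E j) g : R) *: c j).

Definition simple (f : G -> X1) : Prop :=
  exists (r : nat) (c : 'I_r -> X1) (E : 'I_r -> set G), simple_rep f c E.

Definition is_simple_integral (f : G -> X1) (A : set G) (v : X) : Prop :=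
  exists (r : nat) (c : 'I_r -> X1) (E : 'I_r -> set G),
    simple_rep f c E /\ v = \sum_(j < r) m (c j) (pval (mu (A `&` E j))).

(* The value does not depend on the representation chosen. *)
Definition simple_integral (f : G -> X1) (A : set G) : X :=
  xget 0 [set v | is_simple_integral f A v].

Definition cvg_in_mu_measure (f_ : nat -> G -> X1) (f : G -> X1)
    (A : set G) : Prop :=
  exists E : nat -> set G,
    [/\ forall n, measurable (E n),
        pext_cvto cv2 (fun n => mu (A `&` E n)) 0 &
        sup_cvto0 cv1
          (fun n => [set vabs (f_ n g - f g) | g in A `\` E n])].

Definition vabsf (f : G -> X1) : G -> X1 := fun g => vabs (f g).

Definition equi_abs_continuous (f_ : nat -> G -> X1) : Prop :=
  (forall A : nat -> set G, (forall n, measurable (A n)) ->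
    pext_cvto cv2 (fun n => mu (A n)) 0 ->
    cvto cv (fun n => simple_integral (vabsf (f_ n)) (A n)) 0) /\
  (exists B : nat -> set G,
    [/\ forall k, measurable (B k) /\ pfinite (mu (B k)),
        forall k, B k `<=` B k.+1 &
        pext_cvto cv (fun k =>
          cv_limsup cv (fun n => simple_integral (vabsf (f_ n)) (~` B k))) 0]).

Definition defining_sequence (f_ : nat -> G -> X1) (f : G -> X1) : Prop :=
  [/\ forall n, simple (f_ n),
      forall A, measurable A -> pfinite (mu A) -> cvg_in_mu_measure f_ f A &
      equi_abs_continuous f_].

Definition is_pos_integral (f : G -> X1) (l : set G -> X) : Prop :=
  exists2 f_ : nat -> G -> X1, defining_sequence f_ f &
    sup_cvto0 cv (fun n =>
      [set vabs (simple_integral (f_ n) A - l A) | A in measurable]).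

Definition pos_integrable (f : G -> X1) : Prop :=
  (forall g, 0 <= f g) /\ exists l, is_pos_integral f l.

(* The value does not depend on the defining sequence chosen. *)
Definition pos_integral (f : G -> X1) (A : set G) : X :=
  xget 0 [set v | exists2 l, is_pos_integral f l & v = l A].

Definition pos_part (f : G -> X1) : G -> X1 := fun g => vjoin (f g) 0.
Definition neg_part (f : G -> X1) : G -> X1 := fun g => vjoin (- f g) 0.

Definition mu_integrable (f : G -> X1) : Prop :=
  pos_integrable (pos_part f) /\ pos_integrable (neg_part f).

Definition mu_integral (f : G -> X1) (A : set G) : X :=
  pos_integral (pos_part f) A - pos_integral (neg_part f) A.

End Integral.

(* Main.v *)
(* A Vitali theorem gives the result: if nonnegative functions tend to 0 in
   measure and their integrals are equiabsolutely continuous, then the integrals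
   over G tend to 0. It only uses that the integrals are monotone and
   subadditive set functions, bounded by c . mu(A) whenever the function is at
   most c on A, with mu(A) finite. Applied to differences of defining sequences,
   it shows that the integral of a positive function is well defined and
   monotone. Applied to |f_n|, whose integrals are dominated by the absolutely
   continuous integral of h, it gives the theorem. *)
Require Import Defs.
From mathcomp Require Import all_boot all_order all_algebra.
From mathcomp Require Import all_classical all_reals all_analysis.

Set Implicit Arguments.
Unset Strict Implicit.
Unset Printing Implicit Defensive.

Import Order.TTheory GRing.Theory Num.Theory.

Local Open Scope classical_set_scope.
Local Open Scope ring_scope.

(** * Order and absolute value in vector lattices *)

Section VectorLattice.
Context {R : realType} {Y : dvlatType R}.
Implicit Types x y z : Y.

Lemma levD2r z x y : (x + z <= y + z) = (x <= y).
Proof.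
by apply/idP/idP => [/(lev_add2r (- z))|/lev_add2r//]; rewrite !addrK.
Qed.

Lemma levD x y z t : x <= y -> z <= t -> x + z <= y + t.
Proof.
move=> xy zt; apply: (@le_trans _ _ (y + z)); first by rewrite levD2r.
by rewrite ![y + _]addrC levD2r.
Qed.

Lemma levBl x y z : (x - y <= z) = (x <= z + y).
Proof. by rewrite -(levD2r y (x - y)) subrK. Qed.

Lemma levBr x y z : (x <= z - y) = (x + y <= z).
Proof. by rewrite -(levD2r y x) subrK. Qed.

Lemma subv_ge0 x y : (0 <= y - x) = (x <= y).
Proof. by rewrite levBr add0r. Qed.

Lemma levN2 x y : (- x <= - y) = (y <= x).
Proof. by rewrite -(subv_ge0 (- x)) opprK addrC subv_ge0. Qed.

Lemma addv_ge0 x y : 0 <= x -> 0 <= y -> 0 <= x + y.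
Proof. by move=> x0 y0; rewrite -(addr0 0); exact: levD. Qed.

Lemma levDl x y : 0 <= y -> x <= x + y.
Proof. by move=> y0; rewrite -{1}(addr0 x); exact: levD. Qed.

Lemma le_vjoinl x y : x <= vjoin x y.
Proof. by have := lexx (vjoin x y); rewrite ge_vjoin => /andP[]. Qed.

Lemma le_vjoinr x y : y <= vjoin x y.
Proof. by have := lexx (vjoin x y); rewrite ge_vjoin => /andP[]. Qed.

Lemma vjoinl x y : y <= x -> vjoin x y = x.
Proof. by move=> yx; apply: le_anti; rewrite le_vjoinl ge_vjoin lexx yx. Qed.

Lemma vjoinr x y : x <= y -> vjoin x y = y.
Proof. by move=> xy; apply: le_anti; rewrite le_vjoinr ge_vjoin lexx xy. Qed.

Lemma vjoinD2r z x y : vjoin (x + z) (y + z) = vjoin x y + z.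
Proof.
apply: le_anti; rewrite ge_vjoin !levD2r le_vjoinl le_vjoinr -levBr ge_vjoin.
by rewrite !levBr le_vjoinl le_vjoinr.
Qed.

Lemma lev_scale2 x y : x <= y -> 2%:R^-1 *: x <= 2%:R^-1 *: y :> Y.
Proof.
by rewrite -subv_ge0 => ?; rewrite -subv_ge0 -scalerBr scalev_ge0// invr_ge0.
Qed.

Lemma scale2_half x : 2%:R^-1 *: (x + x) = x :> Y.
Proof.
by rewrite -mulr2n -[x *+ 2]scaler_nat scalerA mulVf ?scale1r// pnatr_eq0.
Qed.

Lemma lev_double x y : (x + x <= y + y) = (x <= y).
Proof.
apply/idP/idP => [/lev_scale2|xy]; last exact: levD.
by rewrite !scale2_half.
Qed.

(** Twice the absolute value dominates [x + (- x) = 0], and the factor 2 cancels because scaling by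
    one half is monotone. *)
Lemma vabs_ge0 x : 0 <= vabs x.
Proof.
by rewrite -lev_double addr0 -(subrr x) levD ?le_vjoinl ?le_vjoinr.
Qed.

Lemma ler_vabs x : x <= vabs x. Proof. exact: le_vjoinl. Qed.

Lemma lerN_vabs x : - x <= vabs x. Proof. exact: le_vjoinr. Qed.

Lemma vabs_le x y : (vabs x <= y) = (x <= y) && (- x <= y).
Proof. exact: ge_vjoin. Qed.

Lemma vabsN x : vabs (- x) = vabs x.
Proof.
have vN y : vabs (- y) <= vabs y.
  by rewrite vabs_le opprK ler_vabs lerN_vabs.
by apply: le_anti; rewrite vN -{1}(opprK x) vN.
Qed.

Lemma vabsBC x y : vabs (x - y) = vabs (y - x).
Proof. by rewrite -vabsN opprB. Qed.

Lemma vabsD x y : vabs (x + y) <= vabs x + vabs y.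
Proof. by rewrite vabs_le opprD !levD ?ler_vabs ?lerN_vabs. Qed.

Lemma vabsB x y : vabs (x - y) <= vabs x + vabs y.
Proof. by rewrite -(vabsN y); exact: vabsD. Qed.

Lemma vabs_distD x y z t :
  vabs ((x + y) - (z + t)) <= vabs (x - z) + vabs (y - t).
Proof. by rewrite opprD addrACA; exact: vabsD. Qed.

Lemma ger0_vabs x : 0 <= x -> vabs x = x.
Proof.
by move=> x0; apply: vjoinl; apply: (le_trans _ x0); rewrite -oppr0 levN2.
Qed.

Lemma vabs0 : vabs 0 = 0 :> Y. Proof. exact: ger0_vabs. Qed.

(** Translating [vjoin (- x) 0] by [x] gives [vjoin 0 x]. *)
Lemma pos_partB x : vjoin x 0 - vjoin (- x) 0 = x.
Proof.
apply/eqP; rewrite subr_eq addrC -vjoinD2r addNr add0r; apply/eqP.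
by apply: le_anti; rewrite !ge_vjoin !le_vjoinl !le_vjoinr.
Qed.

Lemma vabsE x : vabs x = vjoin x 0 + vjoin (- x) 0.
Proof.
have x0 : 0 <= vjoin x 0 by exact: le_vjoinr.
have y0 : 0 <= vjoin (- x) 0 by exact: le_vjoinr.
apply: le_anti; apply/andP; split.
  rewrite vabs_le; apply/andP; split.
    by apply: (le_trans (le_vjoinl x 0)); exact: levDl.
  by apply: (le_trans (le_vjoinl (- x) 0)); rewrite addrC; exact: levDl.
(* This substitution turns the goal into [vjoin x 0 + vjoin x 0 <= vabs x + x], so it suffices to
   bound [vjoin x 0] by half of the right-hand side. *)
have -> : vjoin (- x) 0 = vjoin x 0 - x.
  by rewrite -{3}(pos_partB x) opprB addrC subrK.
rewrite addrA levBl.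
have xh : vjoin x 0 <= 2%:R^-1 *: (vabs x + x).
  rewrite ge_vjoin -{1}(scale2_half x) lev_scale2 ?levD2r ?ler_vabs//=.
  by rewrite scalev_ge0 ?invr_ge0// -levBl sub0r lerN_vabs.
by apply: (le_trans (levD xh xh)); rewrite -scalerDr scale2_half.
Qed.

Lemma le_pos_part x y : x <= y -> 0 <= y -> vjoin x 0 <= y.
Proof. by rewrite ge_vjoin => -> ->. Qed.

End VectorLattice.

(** * Limits and limits superior in an abstract convergence *)

Section Convergence.
Context {R : realType} {Y : dvlatType R} (cv : convergence Y).
Implicit Types (x y z : nat -> Y) (a b c : Y).

Lemma cvtoD x y a b :
  cvto cv x a -> cvto cv y b -> cvto cv (fun n => x n + y n) (a + b).
Proof.
move=> [dx <-] [dy <-].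
have -> : (fun n => x n + y n) = (fun n => 1 *: x n + 1 *: y n).
  by apply/funext => n; rewrite !scale1r.
by split; [exact: cv_dom_linear | rewrite cv_lim_linear// !scale1r].
Qed.

Lemma cvtoN x a : cvto cv x a -> cvto cv (fun n => - x n) (- a).
Proof.
move=> [dx <-].
have -> : (fun n => - x n) = (fun n => (-1) *: x n + 0 *: x n).
  by apply/funext => n; rewrite scaleN1r scale0r addr0.
split; first exact: cv_dom_linear.
by rewrite cv_lim_linear// scaleN1r scale0r addr0.
Qed.

Lemma cvto_cst c : cvto cv (fun=> c) c.
Proof. by apply: cv_cst; exact: nearW. Qed.

Lemma cvto_le x y a b :
  cvto cv x a -> cvto cv y b -> (forall n, x n <= y n) -> a <= b.
Proof. by move=> [dx <-] [dy <-] xy; apply: cv_lim_le => //; exact: nearW. Qed.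

Lemma cvto_unique x a b : cvto cv x a -> cvto cv x b -> a = b.
Proof. by move=> [_ <-] [_ <-]. Qed.

(** The axiom [cv_squeeze] only puts [y] in the domain; monotonicity of the limit then pins its
    value from both sides. *)
Lemma cvto_squeeze x y z a : cvto cv x a -> cvto cv z a ->
  (forall n, x n <= y n /\ y n <= z n) -> cvto cv y a.
Proof.
move=> xa za xyz; have dy : cv_dom cv y.
  case: (xa) (za) => dx lx [dz lz].
  apply: (cv_squeeze dx dz); first by rewrite lx lz.
  exact: nearW.
have ylim : cvto cv y (cv_lim cv y) by [].
split=> //; apply: le_anti; apply/andP; split.
  by apply: (cvto_le ylim za) => n; case: (xyz n).
by apply: (cvto_le xa ylim) => n; case: (xyz n).
Qed.

Lemma cvto0_le x y :
  cvto cv y 0 -> (forall n, 0 <= x n) -> (forall n, x n <= y n) -> cvto cv x 0.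
Proof.
by move=> y0 x0 xy; apply: (cvto_squeeze (cvto_cst 0) y0) => n; split.
Qed.

Lemma cvto0_sum r (x : 'I_r -> nat -> Y) : (forall j, cvto cv (x j) 0) ->
  cvto cv (fun n => \sum_(j < r) x j n) 0.
Proof.
elim: r x => [|r IH] x x0.
  by under eq_fun do rewrite big_ord0; exact: cvto_cst.
under eq_fun do rewrite big_ord_recl.
by rewrite -[X in cvto _ _ X]addr0; apply: cvtoD => //; exact: IH.
Qed.

Lemma cvto_dist x z a :
  cvto cv z 0 -> (forall n, vabs (x n - a) <= z n) -> cvto cv x a.
Proof.
move=> z0 xz; apply: (@cvto_squeeze (fun n => - z n + a) _ (fun n => z n + a)).
- rewrite -[X in cvto _ _ X]add0r -oppr0.
  by apply: cvtoD (cvtoN z0) (cvto_cst a).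
- by rewrite -[X in cvto _ _ X]add0r; apply: cvtoD z0 (cvto_cst a).
move=> n; have := xz n; rewrite vabs_le opprB !levBl => /andP[xza azx].
by split=> //; rewrite addrC levBl addrC.
Qed.

(** Bounds on limits superior are stated against a finite value, so that they exclude [pinf] as
    well. *)
Lemma limsup_le_fin x y c : (forall n, 0 <= x n) -> (forall n, x n <= y n) ->
  pext_le (cv_limsup cv y) (pfin c) -> pext_le (cv_limsup cv x) (pfin c).
Proof.
move=> x0 xy; have y0 n : 0 <= y n by exact: le_trans (xy n).
have xyn : \forall n \near \oo, x n <= y n by exact: nearW.
have := cv_limsup_le cv x0 y0 xyn.
case: (cv_limsup cv x) => [u|]; case: (cv_limsup cv y) => [v|] //=.
exact: le_trans.
Qed.

Lemma limsupD_le_fin x y a b : (forall n, 0 <= x n) -> (forall n, 0 <= y n) ->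
  pext_le (cv_limsup cv x) (pfin a) -> pext_le (cv_limsup cv y) (pfin b) ->
  pext_le (cv_limsup cv (fun n => x n + y n)) (pfin (a + b)).
Proof.
move=> x0 y0; have := cv_limsupD cv x0 y0.
case: (cv_limsup cv x) => // u; case: (cv_limsup cv y) => // v.
case: cv_limsup => //= w wuv ua vb; exact: (le_trans wuv (levD ua vb)).
Qed.

Lemma cvto_limsup x a :
  (forall n, 0 <= x n) -> cvto cv x a -> cv_limsup cv x = pfin a.
Proof. by move=> x0 [dx <-]; exact: cv_limsup_lim. Qed.

(** The limit superior is one fixed element below every [w k], hence below the limit 0 of [w]; a
    sequence whose limit superior is 0 converges to 0. *)
Lemma cvto0_of_limsup x (w : nat -> Y) : (forall n, 0 <= x n) ->
  cvto cv w 0 -> (forall k, pext_le (cv_limsup cv x) (pfin (w k))) ->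
  cvto cv x 0.
Proof.
move=> x0 w0 xw; apply: cv_limsup_eq0 => //; have := cv_limsup_ge0 cv x0.
case: cv_limsup xw => [c /= cw c0|/(_ 0%N)//]; congr pfin.
by apply: le_anti; rewrite c0 andbT; exact: cvto_le (cvto_cst c) w0 cw.
Qed.

(** Any upper bounds tending to 0 do in place of the suprema: the latter exist by Dedekind
    completeness and are squeezed between 0 and the bounds. *)
Lemma sup_cvto0P (S : nat -> set Y) : sup_cvto0 cv S <->
  exists z, [/\ cvto cv z 0, forall n, 0 <= z n & forall n, ubound (S n) (z n)].
Proof.
split=> [[z zsup z0]|[z [z0 zge0 zub]]].
  exists z; split=> // n; have [zn _] := zsup n; first by apply: zn; left.
  by move=> y Sy; apply: zn; right.
have ubz n : ubound (0 |` S n) (z n) by move=> y [->//|]; exact: zub.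
have /choice[s ssup] n : exists s, supremums (0 |` S n) s.
  apply: vlat_complete; split; first by exists 0; left.
  by exists (z n).
exists s => //; apply: (cvto0_le z0) => n; have [s1 s2] := ssup n.
  by apply: s1; left.
exact: s2.
Qed.

(** Finiteness is kept as a separate condition, so the default value of [pval] at [pinf] never
    matters. *)
Lemma pext_cvtoP (x : nat -> pext Y) c : pext_cvto cv x c <->
  (forall n, pfinite (x n)) /\ cvto cv (fun n => pval (x n)) c.
Proof.
split=> [[y xy yc]|[xfin xc]].
  split=> [n|]; first by exists (y n).
  by have -> : (fun n => pval (x n)) = y by apply/funext => n; rewrite xy.
by exists (fun n => pval (x n)) => // n; case: (xfin n) => y ->.
Qed.

End Convergence.

(** * Sets of finite measure *)

Lemma setU_setD T (A B : set T) : A `|` B = A `|` (B `\` A).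
Proof. by rewrite setUDr setDv setD0. Qed.

Lemma sub_bigsetU_ord T r (E : 'I_r -> set T) j :
  E j `<=` \big[setU/set0]_(i < r) E i.
Proof. by move=> x Ex; rewrite (bigD1 j)//=; left. Qed.

Section FiniteMeasure.
Context {R : realType} {X2 : dvlatType R} {d : measure_display}
  {G : algebraOfSetsType d} (mu : set G -> pext X2).
Context (mu_measure : fin_add_measure mu).
Implicit Types A B E : set G.

Definition finite_mu A := measurable A /\ pfinite (mu A).
Definition nu A : X2 := pval (mu A).

Lemma nu_set0 : nu set0 = 0.
Proof. by rewrite /nu fam_set0. Qed.

Lemma finite_mu_set0 : finite_mu set0.
Proof. by split; [exact: measurable0 | exists 0; exact: fam_set0]. Qed.

Lemma nu_ge0 A : measurable A -> 0 <= nu A.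
Proof. by move=> /(fam_ge0 mu_measure); rewrite /nu; case: (mu A). Qed.

(** By additivity [mu A] is a summand of [mu B], and a sum with a summand [pinf] is not finite. *)
Lemma finite_muS A B : measurable A -> A `<=` B -> finite_mu B -> finite_mu A.
Proof.
move=> mA AB [mB [b muB]]; split=> //; move: muB.
rewrite -(setDUK AB) fam_setU// ?setDIK//; last exact: measurableD.
by case: (mu A) => [a|] //= _; exists a.
Qed.

Lemma finite_muIl A B : finite_mu A -> measurable B -> finite_mu (A `&` B).
Proof.
move=> fA mB; have [mA _] := fA.
by apply: finite_muS fA; [exact: measurableI | exact: subIsetl].
Qed.

Lemma finite_muD A B : finite_mu A -> measurable B -> finite_mu (A `\` B).
Proof. by rewrite setDE => fA mB; apply/finite_muIl/measurableC. Qed.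

Lemma nuU A B : finite_mu A -> finite_mu B -> A `&` B = set0 ->
  nu (A `|` B) = nu A + nu B.
Proof.
by move=> [mA [a muA]] [mB [b muB]] AB0; rewrite /nu fam_setU// muA muB.
Qed.

Lemma finite_muU A B : finite_mu A -> finite_mu B -> finite_mu (A `|` B).
Proof.
move=> fA fB; have [mA _] := fA; have [mB _] := fB.
have fBA : finite_mu (B `\` A).
  by apply: finite_muS fB; [exact: measurableD | exact: subDsetl].
split; first exact: measurableU.
rewrite setU_setD fam_setU ?setDIK//; last exact: measurableD.
case: fA fBA => _ [a ->] [_ [b ->]]; by exists (a + b).
Qed.

Lemma finite_mu_bigsetU r (E : 'I_r -> set G) :
  (forall j, finite_mu (E j)) -> finite_mu (\big[setU/set0]_(j < r) E j).
Proof.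
move=> fE; elim/big_ind : _ => // [|A B]; first exact: finite_mu_set0.
exact: finite_muU.
Qed.

Lemma nuID E A : finite_mu A -> measurable E ->
  nu A = nu (A `&` E) + nu (A `\` E).
Proof.
move=> fA mE; have [mA _] := fA.
rewrite -nuU ?setUIDK//.
- exact: finite_muIl.
- exact: finite_muD.
- by rewrite setDE setIACA setICr setI0.
Qed.

Lemma nuS A B : measurable A -> A `<=` B -> finite_mu B -> nu A <= nu B.
Proof.
move=> mA AB fB; rewrite (nuID fB mA) (setIidr AB) levDl// nu_ge0//.
by apply: measurableD => //; case: fB.
Qed.

End FiniteMeasure.

(** * Zero, opposites and positivity for the product *)

Section ProductTriple.
Context {R : realType} {X1 X2 X : dvlatType R}.
Context (cv1 : convergence X1) (cv2 : convergence X2) (cv : convergence X).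
Context (m : X1 -> X2 -> X).
Context (triple : product_triple cv1 cv2 cv m).

Lemma m0l y : m 0 y = 0.
Proof. by apply: (@addrI _ (m 0 y)); rewrite -(pt_addl triple) !addr0. Qed.

Lemma m0r x : m x 0 = 0.
Proof. by apply: (@addrI _ (m x 0)); rewrite -(pt_addr triple) !addr0. Qed.

Lemma mNl x y : m (- x) y = - m x y.
Proof. by apply: (@addrI _ (m x y)); rewrite -(pt_addl triple) !subrr m0l. Qed.

Lemma m_ge0 x y : 0 <= x -> 0 <= y -> 0 <= m x y.
Proof. by move=> x0 y0; rewrite -(m0l y); exact: pt_monol triple _ _ _ _ _. Qed.

End ProductTriple.

(** * Closure properties of simple functions *)

Section SimpleFunctions.
Context {R : realType} {X1 X2 : dvlatType R}.
Context {d : measure_display} {G : algebraOfSetsType d}.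
Context (mu : set G -> pext X2).
Context (mu_measure : fin_add_measure mu).
Local Notation finite_mu := (finite_mu mu).
Local Notation simple := (simple mu).
Implicit Types (A B E : set G) (f : G -> X1).

(** The two representations are concatenated. The identity for arbitrary [F] is what later makes the
    integral additive, with [F] the product of the coefficient and the measure. *)
Lemma simple_repD f f' r r' (c : 'I_r -> X1) (E : 'I_r -> set G)
    (c' : 'I_r' -> X1) (E' : 'I_r' -> set G) :
  simple_rep mu f c E -> simple_rep mu f' c' E' ->
  exists (r'' : nat) (c'' : 'I_r'' -> X1) (E'' : 'I_r'' -> set G),
    simple_rep mu (fun g => f g + f' g) c'' E'' /\
    forall (V : zmodType) (F : X1 -> set G -> V),
      \sum_(j < r'') F (c'' j) (E'' j) =
      \sum_(j < r) F (c j) (E j) + \sum_(j < r') F (c' j) (E' j).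
Proof.
move=> [fE fE_sum] [fE' fE'_sum].
have splitl i : fintype.split (lshift r' i) = inl i := unsplitK (inl i).
have splitr i : fintype.split (rshift r i) = inr i := unsplitK (inr i).
exists (r + r')%N,
  (fun j => match fintype.split j with inl i => c i | inr i => c' i end),
  (fun j => match fintype.split j with inl i => E i | inr i => E' i end).
split; last first.
  move=> V F; rewrite big_split_ord /=.
  by congr (_ + _); apply: eq_bigr => i _; rewrite ?splitl ?splitr.
split=> [j|g]; first by case: fintype.split => i; [exact: fE | exact: fE'].
rewrite big_split_ord fE_sum fE'_sum /=.
by congr (_ + _); apply: eq_bigr => i _; rewrite ?splitl ?splitr.
Qed.

Lemma simple_repN f r (c : 'I_r -> X1) (E : 'I_r -> set G) :
  simple_rep mu f c E -> simple_rep mu (fun g => - f g) (fun j => - c j) E.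
Proof.
move=> [fE fE_sum]; split=> // g; rewrite fE_sum -sumrN.
by apply: eq_bigr => j _; rewrite scalerN.
Qed.

Lemma simpleD f f' : simple f -> simple f' -> simple (fun g => f g + f' g).
Proof.
move=> [r [c [E rf]]] [r' [c' [E' rg]]].
by have [r2 [c2 [E2 [rfg _]]]] := simple_repD rf rg; exists r2, c2, E2.
Qed.

Lemma simpleN f : simple f -> simple (fun x => - f x).
Proof.
by move=> [r [c [E rf]]]; exists r, (fun j => - c j), E; exact: simple_repN.
Qed.

Lemma simple_rep_indic B (c : X1) : finite_mu B ->
  simple_rep mu (fun g => (\1_B g : R) *: c) (fun _ : 'I_1 => c) (fun=> B).
Proof. by move=> fB; split=> // g; rewrite big_ord1. Qed.

Lemma simple_indic B (c : X1) :
  finite_mu B -> simple (fun g => (\1_B g : R) *: c).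
Proof.
by move=> fB; exists 1%N, (fun=> c), (fun=> B); exact: simple_rep_indic.
Qed.

(** The accumulator [c0] makes an induction on [r] possible, without refining the sets to disjoint
    ones: [B] is split along [E ord0], and on the part inside it [c ord0] is absorbed into [c0].
    With no sets left, [phi] is applied to a constant. *)
Lemma simple_comp_cst (phi : X1 -> X1) r (c : 'I_r -> X1) (E : 'I_r -> set G)
    B c0 : (forall j, measurable (E j)) -> finite_mu B ->
  simple (fun g => (\1_B g : R) *:
    phi (c0 + \sum_(j < r) (\1_(E j) g : R) *: c j)).
Proof.
elim: r c E B c0 => [|r IH] c E B c0 mE fB.
  rewrite [X in simple X](_ : _ = fun g => (\1_B g : R) *: phi c0).
    exact: simple_indic.
  by apply/funext => g; rewrite big_ord0 addr0.
have [mB _] := fB; have mE0 := mE ord0.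
have fBI : finite_mu (B `&` E ord0) by exact: finite_muIl.
have fBD : finite_mu (B `\` E ord0) by exact: finite_muD.
have mE' j : measurable (E (lift ord0 j)) by [].
have := simpleD (IH (fun j => c (lift ord0 j)) _ _ (c0 + c ord0) mE' fBI)
                (IH (fun j => c (lift ord0 j)) _ _ c0 mE' fBD).
congr (simple _); apply/funext => g.
rewrite big_ord_recl !indicE in_setI in_setD.
case: (g \in B); case: (g \in E ord0);
  rewrite /= ?scale1r ?scale0r ?addr0 ?add0r//.
by rewrite addrA.
Qed.

(** The union of the sets of a representation has finite measure and serves as [B]; outside of it
    [f] vanishes, and so does its image since [phi 0 = 0]. *)
Lemma simple_comp (phi : X1 -> X1) f :
  phi 0 = 0 -> simple f -> simple (fun g => phi (f g)).
Proof.
move=> phi0 [r [c [E [fE fE_sum]]]].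
have fU : finite_mu (\big[setU/set0]_(j < r) E j).
  exact: finite_mu_bigsetU.
have mE j : measurable (E j) by case: (fE j).
have := simple_comp_cst phi c 0 mE fU.
congr (simple _); apply/funext => g; rewrite add0r -fE_sum indicE.
have [gE|gE] := boolP (g \in _); first by rewrite scale1r.
rewrite scale0r fE_sum big1 ?phi0// => j _; rewrite indicE memNset ?scale0r//.
move=> Ejg; move/negP: gE; apply; apply/mem_set.
exact: (@sub_bigsetU_ord _ _ _ j).
Qed.

Lemma simple_vabs f : simple f -> simple (vabsf f).
Proof. by apply: simple_comp; exact: vabs0. Qed.

Lemma simple_pos_part f : simple f -> simple (pos_part f).
Proof. by apply: (@simple_comp (fun x => vjoin x 0)); exact: vjoinl. Qed.

Lemma simple_cst0 : simple (fun=> 0 : X1).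
Proof.
exists 0%N, (fun=> 0), (fun=> set0).
by split=> [j|g]; [exact: finite_mu_set0 | rewrite big_ord0].
Qed.

End SimpleFunctions.

(** * The integral of simple functions *)

Section SimpleIntegral.
Context {R : realType} {X1 X2 X : dvlatType R}.
Context (cv1 : convergence X1) (cv2 : convergence X2) (cv : convergence X).
Context (m : X1 -> X2 -> X).
Context (triple : product_triple cv1 cv2 cv m).
Context {d : measure_display} {G : algebraOfSetsType d}.
Context (mu : set G -> pext X2).
Context (mu_measure : fin_add_measure mu).
Local Notation finite_mu := (finite_mu mu).
Local Notation nu := (nu mu).
Local Notation sint := (simple_integral m mu).
Local Notation simple := (simple mu).
Implicit Types (A B E : set G) (f : G -> X1).

Definition rep_integral r (c : 'I_r -> X1) (E : 'I_r -> set G) A : X :=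
  \sum_(j < r) m (c j) (nu (A `&` E j)).

(* Induction on the number of sets: B is split by the first one, whose
   coefficient is absorbed into c0 on B `&` E ord0. *)
Lemma rep_integral_ge0_cst r (c : 'I_r -> X1) (E : 'I_r -> set G) B c0 :
  (forall j, measurable (E j)) -> finite_mu B ->
  (forall g, B g -> 0 <= c0 + \sum_(j < r) (\1_(E j) g : R) *: c j) ->
  0 <= m c0 (nu B) + rep_integral c E B.
Proof.
rewrite /rep_integral; elim: r c E B c0 => [|r IH] c E B c0 mE fB ge0.
  (* Only a point of [B] tells that [c0] is nonnegative; for empty [B] the measure is 0. *)
  rewrite big_ord0 addr0; have [->|/set0P[g Bg]] := eqVneq B set0.
    by rewrite nu_set0// (m0r triple).
  have := ge0 g Bg; rewrite big_ord0 addr0 => c0_ge0.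
  by apply: (m_ge0 triple) => //; apply: nu_ge0 => //; case: fB.
have [mB _] := fB; have mE0 := mE ord0.
have fBI : finite_mu (B `&` E ord0) by exact: finite_muIl.
have fBD : finite_mu (B `\` E ord0) by exact: finite_muD.
rewrite big_ord_recl (nuID mu_measure fB mE0) (pt_addr triple).
under eq_bigr => j _.
  have fBE : finite_mu (B `&` E (lift ord0 j)).
    exact: finite_muIl.
  rewrite (nuID mu_measure fBE mE0) (pt_addr triple) setIAC.
  rewrite [_ `\` _]setDE (setIAC B _ (~` _)) -setDE.
  over.
rewrite big_split /=.
have -> : forall a b e u v : X, a + b + (e + (u + v)) = (a + e + u) + (b + v).
  by move=> a b e u v; rewrite addrACA !addrA (addrAC (a + e)).
rewrite -(pt_addl triple).
apply: addv_ge0;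
  apply: (IH (fun j => c (lift ord0 j)) (fun j => E (lift ord0 j))) => //;
  move=> g [Bg Eg]; have := ge0 g Bg.
  by rewrite big_ord_recl indicE mem_set// scale1r addrA.
by rewrite big_ord_recl indicE memNset// scale0r add0r.
Qed.

(** [A] may have infinite measure, so it is first cut down to the union of the sets [E j], which
    leaves the sum unchanged; then [c0] is taken to be 0. *)
Lemma rep_integral_ge0 f r (c : 'I_r -> X1) (E : 'I_r -> set G) A :
  simple_rep mu f c E -> measurable A -> (forall g, A g -> 0 <= f g) ->
  0 <= rep_integral c E A.
Proof.
move=> [fE fE_sum] mA f0; pose B := A `&` \big[setU/set0]_(j < r) E j.
have fU : finite_mu (\big[setU/set0]_(j < r) E j).
  exact: finite_mu_bigsetU.
have fB : finite_mu B.
  by rewrite /B setIC; exact: finite_muIl.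
have -> : rep_integral c E A = m 0 (nu B) + rep_integral c E B.
  rewrite (m0l triple) add0r; apply: eq_bigr => j _; congr (m _ (nu _)).
  rewrite /B -setIA; congr (_ `&` _); apply/esym/setIidr.
  exact: sub_bigsetU_ord.
apply: rep_integral_ge0_cst => // [j|g [Ag _]]; first by case: (fE j).
by rewrite add0r -fE_sum f0.
Qed.

Lemma rep_integralN r (c : 'I_r -> X1) (E : 'I_r -> set G) A :
  rep_integral (fun j => - c j) E A = - rep_integral c E A.
Proof.
by rewrite /rep_integral -sumrN; apply: eq_bigr => j _; rewrite (mNl triple).
Qed.

(** Concatenating one representation with the negated other one represents the difference, so
    positivity suffices. As the two representations are unrelated, equal functions get equal sums,
    which makes the integral well defined. *)
Lemma rep_integral_le f f' r r' (c : 'I_r -> X1) (E : 'I_r -> set G)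
    (c' : 'I_r' -> X1) (E' : 'I_r' -> set G) A :
  simple_rep mu f c E -> simple_rep mu f' c' E' -> measurable A ->
  (forall g, A g -> f g <= f' g) ->
  rep_integral c E A <= rep_integral c' E' A.
Proof.
move=> rf rf' mA ff'.
have [r2 [c2 [E2 [rff' sum2]]]] := simple_repD rf' (simple_repN rf).
rewrite -subv_ge0 -rep_integralN /rep_integral.
rewrite -(sum2 _ (fun x B => m x (nu (A `&` B)))).
apply: rep_integral_ge0 rff' mA _.
by move=> g Ag; rewrite subv_ge0; exact: ff'.
Qed.

Lemma simple_integralE f r (c : 'I_r -> X1) (E : 'I_r -> set G) A :
  simple_rep mu f c E -> measurable A ->
  simple_integral m mu f A = rep_integral c E A.
Proof.
move=> rf mA; apply: xget_subset1; first by exists r, c, E.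
move=> _ _ [r1 [c1 [E1 [rf1 ->]]]] [r2 [c2 [E2 [rf2 ->]]]].
by apply: le_anti; apply/andP; split; apply: rep_integral_le mA _ => //;
  try eassumption.
Qed.

Lemma sintD f f' A : simple f -> simple f' -> measurable A ->
  sint (fun g => f g + f' g) A = sint f A + sint f' A.
Proof.
move=> [r [c [E rf]]] [r' [c' [E' rg]]] mA.
have [r2 [c2 [E2 [rfg sum2]]]] := simple_repD rf rg.
rewrite (simple_integralE rfg)// (simple_integralE rf)//.
rewrite (simple_integralE rg)//.
exact: (sum2 _ (fun x B => m x (nu (A `&` B)))).
Qed.

Lemma sintN f A : simple f -> measurable A ->
  sint (fun x => - f x) A = - sint f A.
Proof.
move=> [r [c [E rf]]] mA; rewrite (simple_integralE rf)//.
by rewrite (simple_integralE (simple_repN rf))// rep_integralN.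
Qed.

Lemma sint_le f f' A : simple f -> simple f' -> measurable A ->
  (forall g, A g -> f g <= f' g) -> sint f A <= sint f' A.
Proof.
move=> [r [c [E rf]]] [r' [c' [E' rg]]] mA fg.
rewrite (simple_integralE rf)// (simple_integralE rg)//.
exact: rep_integral_le fg.
Qed.

Lemma sint_indic B (c : X1) A : finite_mu B -> measurable A ->
  sint (fun g => (\1_B g : R) *: c) A = m c (nu (A `&` B)).
Proof.
move=> fB mA; rewrite (simple_integralE (simple_rep_indic c fB))//.
by rewrite /rep_integral big_ord1.
Qed.

Lemma sint_ge0 f A : simple f -> measurable A ->
  (forall x, A x -> 0 <= f x) -> 0 <= sint f A.
Proof.
move=> [r [c [E rf]]] mA f0; rewrite (simple_integralE rf)//.
exact: rep_integral_ge0 f0.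
Qed.

Lemma sintU f A B : simple f -> measurable A -> measurable B ->
  A `&` B = set0 -> sint f (A `|` B) = sint f A + sint f B.
Proof.
move=> [r [c [E rf]]] mA mB AB0; have mAB := measurableU _ _ mA mB.
rewrite !(simple_integralE rf)// /rep_integral -big_split.
apply: eq_bigr => j _.
have fE := rf.1 j; have [mE _] := fE.
rewrite /= -(pt_addr triple) setIUl nuU//.
- by rewrite setIC; exact: finite_muIl.
- by rewrite setIC; exact: finite_muIl.
- by rewrite setIACA AB0 set0I.
Qed.

Lemma vabs_sint_le f A : simple f -> measurable A ->
  vabs (sint f A) <= sint (vabsf f) A.
Proof.
move=> sf mA; rewrite vabs_le -sintN//; apply/andP; split.
  by apply: sint_le => //; [exact: simple_vabs | move=> x _; exact: ler_vabs].
apply: sint_le => //; [exact: simpleN | exact: simple_vabs |].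
by move=> x _; exact: lerN_vabs.
Qed.

End SimpleIntegral.

(** * Vitali's theorem for sequences of set functions *)

Section Integral.
Context {R : realType} {X1 X2 X : dvlatType R}.
Context (cv1 : convergence X1) (cv2 : convergence X2) (cv : convergence X).
Context (m : X1 -> X2 -> X).
Context (triple : product_triple cv1 cv2 cv m).
Context {d : measure_display} {G : algebraOfSetsType d}.
Context (mu : set G -> pext X2).
Context (mu_measure : fin_add_measure mu).
Local Notation finite_mu := (finite_mu mu).
Local Notation nu := (nu mu).
Local Notation sint := (simple_integral m mu).
Local Notation simple := (simple mu).
Local Notation is_pos_integral := (is_pos_integral cv1 cv2 cv m mu).
Implicit Types (A B E : set G) (f : G -> X1) (I J K : nat -> set G -> X).

(* I n stands for the integral of the n-th function of a sequence of nonnegative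
   functions; Vitali's theorem is used both for simple functions and for
   integrable ones. *)
Definition submeasures I := [/\ forall n A, measurable A -> 0 <= I n A,
  forall n A B, measurable A -> measurable B -> A `<=` B -> I n A <= I n B &
  forall n A B, measurable A -> measurable B -> I n (A `|` B) <= I n A + I n B].

Definition uniformly_ac I :=
  (forall A : nat -> set G, (forall n, finite_mu (A n)) ->
    cvto cv2 (fun n => nu (A n)) 0 -> cvto cv (fun n => I n (A n)) 0) /\
  exists (B : nat -> set G) (w : nat -> X), [/\ forall k, finite_mu (B k),
    forall k, B k `<=` B k.+1,
    forall k, pext_le (cv_limsup cv (fun n => I n (~` B k))) (pfin (w k)) &
    cvto cv w 0].

(** This is the trace on integrals of convergence in measure to 0: off [E n] the [n]-th function is
    at most [z n]. *)
Definition vanish_in_measure I := forall A, finite_mu A ->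
  exists (E : nat -> set G) (z : nat -> X1), [/\ forall n, measurable (E n),
    cvto cv2 (fun n => nu (A `&` E n)) 0, cvto cv1 z 0 &
    forall n, I n (A `\` E n) <= m (z n) (nu A)].

(** The complement of the union of [B k] and [B' k] lies in both complements, so by monotonicity of
    [I] and [J] the two bounds add up. *)
Lemma uniformly_ac_le I J K : submeasures I -> submeasures J ->
  uniformly_ac I -> uniformly_ac J ->
  (forall n A, measurable A -> 0 <= K n A) ->
  (forall n A, measurable A -> K n A <= I n A + J n A) -> uniformly_ac K.
Proof.
move=> [I0 I_le _] [J0 J_le _] [Iac [B [w [fB Bnd Bw w0]]]].
move=> [Jac [B' [w' [fB' Bnd' Bw' w0']]]] K0 K_le; split.
  move=> A fA A0; rewrite -[X in cvto _ _ X]addr0.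
  have IJ := cvtoD (Iac A fA A0) (Jac A fA A0); rewrite addr0 in IJ *.
  by apply: (cvto0_le IJ) => n; case: (fA n) => mA _; [exact: K0 | exact: K_le].
exists (fun k => B k `|` B' k), (fun k => w k + w' k); split.
- by move=> k; exact: finite_muU.
- by move=> k; exact: setUSS.
- move=> k; have [mB _] := fB k; have [mB' _] := fB' k.
  have mC := measurableC mB; have mC' := measurableC mB'.
  have mCU := measurableC (measurableU _ _ mB mB').
  apply: limsup_le_fin (limsupD_le_fin _ _ (Bw k) (Bw' k)) => n; last 2 first.
  + exact: I0.
  + exact: J0.
  + exact: K0.
  apply: (le_trans (K_le n _ mCU)); apply: levD.
    by apply: I_le => //; apply: subsetC; exact: subsetUl.
  by apply: J_le => //; apply: subsetC; exact: subsetUr.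
- by rewrite -[X in cvto _ _ X]addr0; exact: cvtoD.
Qed.

(* For fixed k, I n [set: G] is at most I n (B k `&` E n) + m (z n) (nu (B k)),
   which tends to 0, plus I n (~` B k), whose limsup is at most w k. *)
Lemma vitali I : submeasures I -> uniformly_ac I -> vanish_in_measure I ->
  cvto cv (fun n => I n [set: G]) 0.
Proof.
move=> [I0 I_le I_U] [Iac [B [w [fB _ Bw w0]]]] Ivan.
apply: (cvto0_of_limsup _ w0) => [n|k]; first exact/I0/measurableT.
have [E [z [mE BE0 z0 zE]]] := Ivan _ (fB k).
have [mB _] := fB k; have mC := measurableC mB.
have fBE n : finite_mu (B k `&` E n) by exact: finite_muIl.
have fBD n : finite_mu (B k `\` E n) by exact: finite_muD.
have a0 := cvtoD (Iac _ fBE BE0) (pt_cvl triple (nu (B k)) z0).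
have a_ge0 n : 0 <= I n (B k `&` E n) + m (z n) (nu (B k)).
  apply: addv_ge0; first by apply: I0; case: (fBE n).
  by apply: le_trans (zE n); apply: I0; case: (fBD n).
have C_ge0 n : 0 <= I n (~` B k) by exact: I0.
rewrite addr0 in a0.
have a_le : pext_le (cv_limsup cv (fun n =>
    I n (B k `&` E n) + m (z n) (nu (B k)))) (pfin 0).
  by rewrite (cvto_limsup a_ge0 a0) /=.
have := limsupD_le_fin a_ge0 C_ge0 a_le (Bw k); rewrite add0r.
apply: limsup_le_fin => n; first exact/I0/measurableT.
rewrite -(setUv (B k)); apply: (le_trans (I_U n _ _ mB mC)); rewrite levD2r.
have [mBE _] := fBE n; have [mBD _] := fBD n.
rewrite -{1}(setUIDK (B k) (E n)); apply: (le_trans (I_U n _ _ mBE mBD)).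
by rewrite levD.
Qed.

Lemma submeasures_additive I : (forall n A, measurable A -> 0 <= I n A) ->
  (forall n A B, measurable A -> measurable B -> A `&` B = set0 ->
    I n (A `|` B) = I n A + I n B) -> submeasures I.
Proof.
move=> I0 I_U; have I_le n A B : measurable A -> measurable B -> A `<=` B ->
    I n A <= I n B.
  move=> mA mB AB; have mBA : measurable (B `\` A) by exact: measurableD.
  by rewrite -(setDUK AB) I_U ?setDIK// levDl// I0.
split=> // n A B mA mB; have mBA : measurable (B `\` A) by exact: measurableD.
by rewrite setU_setD I_U ?setDIK// levD// I_le.
Qed.

Lemma submeasures_sint (f_ : nat -> G -> X1) : (forall n, simple (f_ n)) ->
  (forall n g, 0 <= f_ n g) -> submeasures (fun n A => sint (f_ n) A).
Proof.
move=> sf f0; apply: submeasures_additive => [n A mA|n A B mA mB AB0].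
  exact: (sint_ge0 triple).
exact: (sintU triple).
Qed.

Lemma submeasures_vabs (f_ : nat -> G -> X1) : (forall n, simple (f_ n)) ->
  submeasures (fun n A => sint (vabsf (f_ n)) A).
Proof.
move=> sf; apply: submeasures_sint => [n|n g]; last exact: vabs_ge0.
exact: simple_vabs.
Qed.

(** From right to left, the limits superior lie between 0 and [w k]; hence they are finite and tend
    to 0. *)
Lemma equi_abs_continuousP (f_ : nat -> G -> X1) : (forall n, simple (f_ n)) ->
  equi_abs_continuous cv2 cv m mu f_ <->
  uniformly_ac (fun n A => sint (vabsf (f_ n)) A).
Proof.
move=> sf; have [S0 _ _] := submeasures_vabs sf.
split=> [[fac [B [fB Bnd /pext_cvtoP[w_fin w0]]]]|[fac [B [w [fB Bnd Bw w0]]]]].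
  split=> [A fA A0|].
    apply: fac => [n|]; first by case: (fA n).
    by apply/pext_cvtoP; split=> // n; case: (fA n).
  exists B; eexists; split=> //; last exact: w0.
  by move=> k; case: (w_fin k) => y -> /=.
split=> [A mA /pext_cvtoP[fA A0]|]; first by apply: fac.
exists B; split=> //; apply/pext_cvtoP.
have C0 k := cv_limsup_ge0 cv (fun n => S0 n _ (measurableC (fB k).1)).
split=> [k|].
  by have := Bw k; case: cv_limsup => // y _; exists y.
by apply: (cvto0_le w0) => k; have := Bw k; have := C0 k; case: cv_limsup.
Qed.

Lemma uniformly_ac_defining s f : defining_sequence cv1 cv2 cv m mu s f ->
  uniformly_ac (fun n A => sint (vabsf (s n)) A).
Proof. by move=> [ss _] /(equi_abs_continuousP ss). Qed.

(** * The integral of positive functions *)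

Lemma is_pos_integral_cvto f l A : is_pos_integral f l -> measurable A ->
  exists2 s, defining_sequence cv1 cv2 cv m mu s f &
    cvto cv (fun n => sint (s n) A) (l A).
Proof.
move=> [s sf /sup_cvto0P[z [z0 _ zub]]] mA; exists s => //.
by apply: (cvto_dist z0) => n; apply: zub; exists A.
Qed.

(** The union of the two exceptional sets serves both sequences, and the sum of the two bounds
    controls both deviations. *)
Lemma cvg_in_mu_measure2 (s t : nat -> G -> X1) f f' B : finite_mu B ->
  cvg_in_mu_measure cv1 cv2 mu s f B -> cvg_in_mu_measure cv1 cv2 mu t f' B ->
  exists (E : nat -> set G) (z : nat -> X1), [/\ forall n, measurable (E n),
    cvto cv2 (fun n => nu (B `&` E n)) 0, cvto cv1 z 0, forall n, 0 <= z n &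
    forall n g, B g -> ~ E n g ->
      vabs (s n g - f g) + vabs (t n g - f' g) <= z n].
Proof.
move=> fB; have [mB _] := fB.
move=> [E [mE /pext_cvtoP[fE E0] /sup_cvto0P[z [z0 z_ge0 zub]]]].
move=> [E' [mE' /pext_cvtoP[fE' E'0] /sup_cvto0P[z' [z'0 z'_ge0 z'ub]]]].
exists (fun n => E n `|` E' n), (fun n => z n + z' n); split.
- by move=> n; exact: measurableU.
- have EE' := cvtoD E0 E'0; rewrite addr0 in EE'.
  apply: (cvto0_le EE') => n.
    by apply: nu_ge0 => //; apply: measurableI => //; exact: measurableU.
  rewrite setIUr setU_setD nuU// ?setDIK//.
  + rewrite levD//; apply: nuS => //; last exact: finite_muIl.
    by apply: measurableD; exact: measurableI.
  + exact: finite_muIl.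
  + by apply: finite_muD => //; [exact: finite_muIl | exact: measurableI].
- by rewrite -[X in cvto _ _ X]addr0; exact: cvtoD.
- by move=> n; exact: addv_ge0.
move=> n g Bg NE; apply: levD; [apply: zub | apply: z'ub]; exists g => //;
  split=> // ?; apply: NE; by [left | right].
Qed.

(** In [a - b = (a - x) + (x - y) + (y - b)] the middle term is nonpositive. *)
Lemma pos_part_diff_le (a b x y : X1) : x <= y ->
  vjoin (a - b) 0 <= vabs (a - x) + vabs (b - y).
Proof.
move=> xy; apply: le_pos_part; last by rewrite addv_ge0 ?vabs_ge0.
have -> : a - b = (a - x) + ((x - y) + (y - b)) by rewrite !subrKA.
apply: levD; first exact: ler_vabs.
rewrite -[leRHS]add0r; apply: levD; first by rewrite levBl add0r.
by rewrite vabsBC; exact: ler_vabs.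
Qed.

(* Vitali's theorem, applied to the simple functions (s n - t n)^+, where s and
   t are defining sequences of f and f', shows that their integrals over A tend
   to 0. *)
Lemma is_pos_integral_le f f' l l' A : is_pos_integral f l ->
  is_pos_integral f' l' -> measurable A -> (forall g, A g -> f g <= f' g) ->
  l A <= l' A.
Proof.
move=> fl f'l' mA ff'.
have [s def_s s_l] := is_pos_integral_cvto fl mA.
have [t def_t t_l'] := is_pos_integral_cvto f'l' mA.
have [ss s_cvg _] := def_s; have [st t_cvg _] := def_t.
pose v n g := vjoin (s n g - t n g) 0.
have sv n : simple (v n).
  exact: (simple_pos_part mu_measure (simpleD (ss n) (simpleN (st n)))).
have v0 n g : 0 <= v n g by exact: le_vjoinr.
have [S0 S_le S_U] := submeasures_sint sv v0.
(* The inequality between [f] and [f'] is only known on [A], so the set functions are restricted to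
   [A]. *)
have subm : submeasures (fun n B => sint (v n) (A `&` B)).
  split=> [n B mB|n B C mB mC BC|n B C mB mC];
    have mAB := measurableI _ _ mA mB.
  - exact: S0.
  - by apply: S_le => //; [exact: measurableI | exact: setIS].
  - by rewrite setIUr; apply: S_U => //; exact: measurableI.
(* Since [s n <= t n + v n], the claim follows in the limit once the integrals of [v n] over [A]
   vanish. *)
suff : cvto cv (fun n => sint (v n) (A `&` [set: G])) 0.
  rewrite setIT => vA0; rewrite -[leRHS]addr0.
  apply: (cvto_le s_l (cvtoD t_l' vA0)) => n.
  rewrite -(sintD triple)//; apply: (sint_le triple) => //.
    exact: simpleD.
  by move=> g _; rewrite addrC -levBl; exact: le_vjoinl.
apply: (vitali subm).
  (* Absolute continuity comes from [v n] being at most the sum of the absolute values of [s n] and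
     [t n]. *)
  apply: (uniformly_ac_le (submeasures_vabs ss) (submeasures_vabs st)
    (uniformly_ac_defining def_s) (uniformly_ac_defining def_t)).
    by case: subm.
  move=> n B mB; have svs := simple_vabs mu_measure (ss n).
  have svt := simple_vabs mu_measure (st n).
  rewrite -(sintD triple)//.
  apply: (@le_trans _ _ (sint (v n) B)).
    by apply: S_le => //; exact: measurableI.
  apply: (sint_le triple) => //; first exact: simpleD.
  move=> g _; apply: le_pos_part; rewrite ?addv_ge0 ?vabs_ge0//.
  by rewrite (le_trans _ (vabsB _ _))// ler_vabs.
move=> B fB; have [mB muB] := fB.
have [E [z [mE E0 z0 z_ge0 zub]]] :=
  cvg_in_mu_measure2 fB (s_cvg B mB muB) (t_cvg B mB muB).
exists E, z; split=> //.
move=> n; set D := A `&` _.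
have mD : measurable D by apply: measurableI => //; exact: measurableD.
have -> : nu B = nu (B `&` B) by rewrite setIid.
apply: (@le_trans _ _ (sint (fun g => (\1_B g : R) *: z n) D)).
  apply: (sint_le triple) => //; first exact: simple_indic.
  move=> g [Ag [Bg NEg]]; rewrite indicE mem_set// scale1r.
  by apply: (le_trans (pos_part_diff_le _ _ (ff' g Ag))); exact: zub.
rewrite (sint_indic triple)// setIid; apply: (pt_monor triple) => //.
by apply: nuS => //; exact: measurableI.
Qed.

Lemma is_pos_integral_unique f l l' A : is_pos_integral f l ->
  is_pos_integral f l' -> measurable A -> l A = l' A.
Proof.
move=> fl fl' mA; apply: le_anti.
by rewrite (is_pos_integral_le fl fl')// (is_pos_integral_le fl' fl).
Qed.

Lemma pos_integralE f l A : is_pos_integral f l -> measurable A ->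
  pos_integral cv1 cv2 cv m mu f A = l A.
Proof.
move=> fl mA; apply: xget_subset1; first by exists l.
by move=> _ _ [l1 fl1 ->] [l2 fl2 ->]; exact: (is_pos_integral_unique fl1 fl2).
Qed.

(** The bound [z] is uniform over measurable sets, so a single sequence [s] converges on [A], [B]
    and their union, and additivity passes to the limit. *)
Lemma is_pos_integralU f l A B : is_pos_integral f l -> measurable A ->
  measurable B -> A `&` B = set0 -> l (A `|` B) = l A + l B.
Proof.
move=> [s [ss _ _] /sup_cvto0P[z [z0 _ zub]]] mA mB AB0.
have s_cvg C : measurable C -> cvto cv (fun n => sint (s n) C) (l C).
  by move=> mC; apply: (cvto_dist z0) => n; apply: zub; exists C.
have := cvtoD (s_cvg _ mA) (s_cvg _ mB).
have -> : (fun n => sint (s n) A + sint (s n) B) =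
    (fun n => sint (s n) (A `|` B)).
  by apply/funext => n; rewrite (sintU triple).
by apply: cvto_unique; apply: s_cvg; exact: measurableU.
Qed.

(** The constant sequence is defining: the integral of the absolute value is a finite sum of
    products with measures, each vanishing along null sequences of sets, and it is 0 off the union
    of the sets [E j], which is taken for every [B k]. *)
Lemma is_pos_integral_simple f : simple f -> is_pos_integral f (sint f).
Proof.
move=> sf; exists (fun=> f); last first.
  apply/sup_cvto0P; exists (fun=> 0); split=> //; first exact: cvto_cst.
  by move=> n _ [A mA <-]; rewrite subrr vabs0.
split=> //.
  move=> A mA fA; exists (fun=> set0); split=> //.
    apply/pext_cvtoP; rewrite setI0 fam_set0//.
    by split=> [_|]; [exists 0 | exact: cvto_cst].
  apply/sup_cvto0P; exists (fun=> 0); split=> //; first exact: cvto_cst.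
  by move=> n _ [g _ <-]; rewrite subrr vabs0.
apply/equi_abs_continuousP => //.
have [r [c [E rf]]] := simple_vabs mu_measure sf.
have [mE rfE] := rf.
split=> [A fA A0|].
  have -> : (fun n => sint (vabsf f) (A n)) =
      (fun n => rep_integral m mu c E (A n)).
    apply/funext => n; apply: (simple_integralE triple mu_measure rf).
    by case: (fA n).
  apply: cvto0_sum => j; apply: (pt_cvr triple).
  apply: (cvto0_le A0) => n; have [mA _] := fA n; have [mEj _] := mE j.
    by apply: nu_ge0 => //; exact: measurableI.
  by apply: nuS => //; exact: measurableI.
pose B := \big[setU/set0]_(j < r) E j.
have fB : finite_mu B by exact: finite_mu_bigsetU.
have [mB _] := fB.
have B0 : sint (vabsf f) (~` B) = 0.
  rewrite (simple_integralE triple mu_measure rf); last exact: measurableC.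
  rewrite /rep_integral big1// => j _.
  rewrite (_ : _ `&` _ = set0) ?nu_set0 ?(m0r triple)//.
  rewrite setIC; apply/disjoints_subset; rewrite setCK.
  exact: sub_bigsetU_ord.
exists (fun=> B), (fun=> 0); split=> // [k|k|].
- exact: subset_refl.
- by rewrite B0 (cvto_limsup (fun=> lexx 0) (cvto_cst cv 0)) /=.
- exact: cvto_cst.
Qed.

(** Applied to positive and negative parts, this gives the integrability of absolute values. *)
Lemma is_pos_integralD f f' l l' : is_pos_integral f l ->
  is_pos_integral f' l' ->
  is_pos_integral (fun g => f g + f' g) (fun A => l A + l' A).
Proof.
move=> [s def_s /sup_cvto0P[z [z0 z_ge0 zub]]].
move=> [t def_t /sup_cvto0P[z' [z'0 z'_ge0 z'ub]]].
have [ss s_cvg _] := def_s; have [st t_cvg _] := def_t.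
have sst n : simple (fun g => s n g + t n g) by exact: simpleD.
exists (fun n g => s n g + t n g).
  split=> //; last first.
    apply/equi_abs_continuousP => //.
    apply: (uniformly_ac_le (submeasures_vabs ss) (submeasures_vabs st)
      (uniformly_ac_defining def_s) (uniformly_ac_defining def_t)).
      by case: (submeasures_vabs sst).
    move=> n A mA; have svs := simple_vabs mu_measure (ss n).
    have svt := simple_vabs mu_measure (st n).
    rewrite -(sintD triple)//; apply: (sint_le triple) => //.
    - exact: simple_vabs.
    - exact: simpleD.
    - by move=> g _; exact: vabsD.
  move=> B mB muB.
  have fB : finite_mu B by [].
  have [E [w [mE E0 w0 w_ge0 wub]]] :=
    cvg_in_mu_measure2 fB (s_cvg B mB muB) (t_cvg B mB muB).
  exists E; split=> //.
    apply/pext_cvtoP; split=> // n.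
    by case: (finite_muIl mu_measure fB (mE n)).
  apply/sup_cvto0P; exists w; split=> // n _ [g [Bg NEg] <-].
  by apply: (le_trans (vabs_distD _ _ _ _)); exact: wub.
apply/sup_cvto0P; exists (fun n => z n + z' n); split.
- by rewrite -[X in cvto _ _ X]addr0; exact: cvtoD.
- by move=> n; exact: addv_ge0.
move=> n _ [A mA <-]; rewrite (sintD triple)//.
apply: (le_trans (vabs_distD _ _ _ _)).
by apply: levD; [apply: zub | apply: z'ub]; exists A.
Qed.

Lemma is_pos_integral_ge0 f l A : is_pos_integral f l -> measurable A ->
  (forall g, A g -> 0 <= f g) -> 0 <= l A.
Proof.
move=> fl mA f0; have s0 := @simple_cst0 _ X1 _ _ _ _ mu_measure.
have := is_pos_integral_le (is_pos_integral_simple s0) fl mA f0.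
apply: le_trans.
exact: (sint_ge0 triple).
Qed.

(** The comparison is with [c] times the indicator of [A]; this provides the bound in
    [vanish_in_measure]. *)
Lemma is_pos_integral_le_cst f l A c : is_pos_integral f l -> finite_mu A ->
  (forall g, A g -> f g <= c) -> l A <= m c (nu A).
Proof.
move=> fl fA fc; have [mA _] := fA.
rewrite -{2}(setIid A) -(sint_indic triple)//.
apply: (is_pos_integral_le fl (is_pos_integral_simple (simple_indic _ fA)) mA).
by move=> g Ag; rewrite indicE mem_set// scale1r fc.
Qed.

Lemma submeasures_is_pos_integral (f_ : nat -> G -> X1)
    (l_ : nat -> set G -> X) :
  (forall n, is_pos_integral (f_ n) (l_ n)) -> (forall n g, 0 <= f_ n g) ->
  submeasures l_.
Proof.
move=> fl f0; apply: submeasures_additive => [n A mA|n A B mA mB AB0].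
  by apply: is_pos_integral_ge0 (fl n) mA _ => g _; exact: f0.
exact: is_pos_integralU (fl n) mA mB AB0.
Qed.

(** For every [n], [l] is at most [z n] plus the integral of the absolute value of [s n]. Using this
    bound at the index [n] of the constant sequence transfers both conditions from [s]. *)
Lemma uniformly_ac_is_pos_integral f l : is_pos_integral f l ->
  (forall g, 0 <= f g) -> uniformly_ac (fun=> l).
Proof.
move=> fl f0; have [s def_s /sup_cvto0P[z [z0 z_ge0 zub]]] := fl.
have [l0 _ _] := submeasures_is_pos_integral (fun=> fl) (fun=> f0).
have [ss _ _] := def_s.
have [sac [B [w [fB Bnd Bw w0]]]] := uniformly_ac_defining def_s.
have l_le n A : measurable A -> l A <= z n + sint (vabsf (s n)) A.
  move=> mA; rewrite -(subrK (sint (s n) A) (l A)); apply: levD.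
    apply: (le_trans (ler_vabs _)); rewrite vabsBC.
    by apply: zub; exists A.
  by apply: (le_trans (ler_vabs _)); exact: (vabs_sint_le triple).
split=> [A fA A0|].
  have zA0 := cvtoD z0 (sac A fA A0); rewrite addr0 in zA0.
  apply: (cvto0_le zA0) => n; case: (fA n) => mA _; first exact: (l0 0%N).
  exact: l_le.
exists B, w; split=> // k; have [mB _] := fB k; have mC := measurableC mB.
have z_le : pext_le (cv_limsup cv z) (pfin 0).
  by rewrite (cvto_limsup z_ge0 z0) /=.
have [S0 _ _] := submeasures_vabs ss.
have := limsupD_le_fin z_ge0 (fun n => S0 n _ mC) z_le (Bw k); rewrite add0r.
by apply: limsup_le_fin => n; [exact: (l0 0%N) | exact: l_le].
Qed.

End Integral.

(** * Dominated convergence *)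

Theorem corollary3p14 (R : realType) (X1 X2 X : dvlatType R)
    (cvR : convergence R^o) (cv1 : convergence X1) (cv2 : convergence X2)
    (cv : convergence X) (m : X1 -> X2 -> X)
    (triple : product_triple cv1 cv2 cv m)
    (algebra1 : product_algebra cv1) (algebra2 : product_algebra cv2)
    (algebra : product_algebra cv)
    (tripleR : product_triple cvR cv cv (fun (a : R^o) (x : X) => a *: x))
    (tripleR1 : product_triple cvR cv1 cv1 (fun (a : R^o) (x : X1) => a *: x))
    (tripleR2 : product_triple cvR cv2 cv2 (fun (a : R^o) (x : X2) => a *: x))
    (d : measure_display) (G : algebraOfSetsType d)
    (mu : set G -> pext X2) (mu_measure : fin_add_measure mu)
    (mu_sigma_finite : sigma_finite_fam mu)
    (f_ : nat -> G -> X1) (h : G -> X1)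
    (f_integrable : forall n, mu_integrable cv1 cv2 cv m mu (f_ n))
    (f_cvg : forall A, measurable A -> pfinite (mu A) ->
      cvg_in_mu_measure cv1 cv2 mu f_ (fun=> 0) A)
    (h_integrable : mu_integrable cv1 cv2 cv m mu h)
    (f_le_h : forall n g, vabs (f_ n g) <= h g) :
  (forall n, mu_integrable cv1 cv2 cv m mu (vabsf (f_ n))) /\
  cvto cv (fun n => mu_integral cv1 cv2 cv m mu (vabsf (f_ n)) [set: G]) 0.
Proof.
have absE f : vabsf f = (fun g => pos_part f g + neg_part f g) :> (G -> X1).
  by apply/funext => g; exact: vabsE.
have abs_ge0 n g : 0 <= vabsf (f_ n) g by exact: vabs_ge0.
have h_ge0 g : 0 <= h g := le_trans (vabs_ge0 _) (f_le_h 0%N g).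
have pos_id (f : G -> X1) : (forall g, 0 <= f g) -> pos_part f = f.
  by move=> f0; apply/funext => g; exact: vjoinl.
have neg_id n : neg_part (vabsf (f_ n)) = fun=> 0.
  by apply/funext => g; apply: vjoinr; rewrite -oppr0 levN2.
have [[_ [lh]]] := h_integrable; rewrite (pos_id h h_ge0) => hlh _.
(* The absolute value is the sum of the positive and negative parts, which are integrable by
   hypothesis. *)
have /choice[l fl] n :
    exists l, is_pos_integral cv1 cv2 cv m mu (vabsf (f_ n)) l.
  have [[_ [lp flp]] [_ [lm flm]]] := f_integrable n.
  by rewrite absE; eexists; exact: (is_pos_integralD triple mu_measure flp flm).
have zero_int := is_pos_integral_simple triple mu_measure
  (@simple_cst0 _ X1 _ _ _ _ mu_measure).
have lh_sub := submeasures_is_pos_integral triple mu_measure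
  (fun=> hlh) (fun=> h_ge0).
have lh_ac := uniformly_ac_is_pos_integral triple mu_measure hlh h_ge0.
have l_sub := submeasures_is_pos_integral triple mu_measure fl abs_ge0.
split=> [n|].
  split; first by rewrite pos_id//; split=> //; exists (l n).
  by rewrite neg_id; split=> // ; eexists; exact: zero_int.
(* The negative part is 0, and its integral is computed as an empty sum. *)
have -> : (fun n => mu_integral cv1 cv2 cv m mu (vabsf (f_ n)) [set: G]) =
    (fun n => l n [set: G]).
  apply/funext => n; rewrite /mu_integral pos_id// neg_id.
  rewrite (pos_integralE triple mu_measure (fl n)); last exact: measurableT.
  rewrite (pos_integralE triple mu_measure zero_int); last exact: measurableT.
  have s0 : simple_rep mu (fun=> 0 : X1) (fun _ : 'I_0 => 0) (fun=> set0).
    by split=> [[]//|g]; rewrite big_ord0.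
  rewrite (simple_integralE triple mu_measure s0); last exact: measurableT.
  by rewrite /rep_integral big_ord0 subr0.
apply: (vitali triple mu_measure l_sub).
  (* [uniformly_ac_le] takes a sum of two bounds, so [lh] is used twice; the second copy is only
     nonnegative slack. *)
  apply: (uniformly_ac_le mu_measure lh_sub lh_sub lh_ac lh_ac).
    by case: l_sub.
  move=> n A mA; have [lh0 _ _] := lh_sub.
  apply: (@le_trans _ _ (lh A)); last by rewrite levDl// (lh0 0%N).
  apply: (is_pos_integral_le triple mu_measure (fl n) hlh mA) => g _.
  exact: f_le_h.
move=> A fA; have [mA muA] := fA.
have [E [mE /pext_cvtoP[_ E0] /sup_cvto0P[z [z0 z_ge0 zub]]]] := f_cvg A mA muA.
exists E, z; split=> // n.
have fAE : finite_mu mu (A `\` E n) by exact: finite_muD.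
(* Off [E n] the function is at most [z n]; then the measure is enlarged to that of [A], as [z n] is
   nonnegative. *)
apply: (@le_trans _ _ (m (z n) (nu mu (A `\` E n)))).
  apply: (is_pos_integral_le_cst triple mu_measure (fl n) fAE) => g AEg.
  by apply: zub; exists g => //; rewrite subr0.
by apply: (pt_monor triple) => //; apply: nuS => //; case: fAE.
Qed.
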